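(* Let $A$ be a reproducible multiset, and let $B$ be a reproducible multiset such that $A\subseteq B\subseteq Z(\mathcal S_A)$ (inclusions of multisets, counting multiplicity), where $Z(\mathcal S_A)$ is the multiset of zeros of $\mathcal S_A$ in $\Omega$ together with its zeros at reproducible points, each listed with multiplicity (a reproducible point $\beta$ being counted $m$ times if $\mathcal S_A^{(\ell)}(\beta)=0$ for all $0\le\ell<m$ and $\beta$ is reproducible of order $m-1$). Then $\mathcal S_B$ is a constant multiple of $\mathcal S_A$.
   Context: Standing assumptions: $\Omega\subset\mathbb C$ is a domain with $0\in\Omega$, $\mathcal H$ is a Hilbert space of analytic functions on $\Omega$ with bounded point evaluations at points of $\Omega$, the shift $(Sf)(z)=zf(z)$ is bounded on $\mathcal H$, and the polynomials $\mathcal P$ are dense in $\mathcal H$. A point $\beta\in\mathbb C$ is reproducible of order $m\ge0$ if $p\mapsto p^{(m)}(\beta)$ on $\mathcal P$ extends to a bounded linear functional on $\mathcal H$; the value of the extension at $g\in\mathcal H$ is written $g^{(m)}(\beta)$ and it is represented by $k_\beta^{(m)}\in\mathcal H$. $\beta$ is a reproducible point if reproducible of order $0$; reproducibility of order $m$ implies that of all orders $j\le m$; $\operatorname{ro}(\beta)$ is the supremum of orders of reproducibility. A reproducible multiset is a finite multiset consisting of $0$ with multiplicity $m_0\ge0$ and distinct nonzero reproducible points $\beta_1,\dots,\beta_s$ with multiplicities $1\le m_j\le\operatorname{ro}(\beta_j)+1$. For vectors $u,v_1,\dots,v_N$, $D(u;v_1,\dots,v_N)$ is the formal determinant of the matrix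 with first row $(u,\langle u,v_1\rangle,\dots,\langle u,v_N\rangle)$ and $(i+1)$-st row $(v_i,\langle v_i,v_1\rangle,\dots,\langle v_i,v_N\rangle)$, expanded along the first column. The Shapiro–Shields function of a reproducible multiset $Z$ is $\mathcal S_Z=D(k_0^{(m_0)};k_0^{(m_0-1)},\dots,k_0,k_{\beta_1}^{(m_1-1)},\dots,k_{\beta_1},\dots,k_{\beta_s}^{(m_s-1)},\dots,k_{\beta_s})$. *)

(* Defs.v *)
From HB Require Import structures.
From mathcomp Require Import all_boot all_order all_algebra.
From mathcomp Require Import complex.
From mathcomp Require Import all_classical all_reals topology normedtype derive.
From Stdlib Require Import ClassicalEpsilon.
Set Implicit Arguments.
Unset Strict Implicit.
Unset Printing Implicit Defensive.
Import Order.TTheory GRing.Theory Num.Theory.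
Import numFieldNormedType.Exports.
Local Open Scope ring_scope.

(* The complex numbers, built on an arbitrary model R of the reals.
   Its canonical topology / normed structure (from mathcomp-analysis) is
   the usual one, so [derivable f z 1] and [derive1] are complex derivatives. *)
Definition CC (R : realType) : numClosedFieldType := (R : rcfType)[i].

(* Standing assumptions: a Hilbert space H of analytic functions on a domain
   Omega containing 0, with bounded point evaluations on Omega, bounded shift,
   and dense polynomials.  Elements of H are identified with functions on Omega
   through the injective linear map [ev]. *)
Record AHS (R : realType) := {
  Om : set (CC R);
  Om_open : open Om;
  Om_connected : connected Om;
  Om_0 : Om 0;
  Hsp : lmodType (CC R);
  inner : Hsp -> Hsp -> CC R;
  inner_linl : forall (a : CC R) (x y z : Hsp),
      inner (a *: x + y) z = a * inner x z + inner y z;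
  inner_conj : forall x y : Hsp, inner y x = (inner x y)^*;
  inner_ge0 : forall x : Hsp, 0 <= inner x x;
  inner_eq0 : forall x : Hsp, inner x x = 0 -> x = 0;
  complete : forall u : nat -> Hsp,
      (forall e : CC R, 0 < e -> exists N : nat, forall m n : nat,
          (N <= m)%N -> (N <= n)%N -> inner (u m - u n) (u m - u n) < e) ->
      exists x : Hsp, forall e : CC R, 0 < e -> exists N : nat, forall n : nat,
          (N <= n)%N -> inner (u n - x) (u n - x) < e;
  ev : Hsp -> CC R -> CC R;
  ev_lin : forall (a : CC R) (f g : Hsp) (z : CC R), Om z ->
      ev (a *: f + g) z = a * ev f z + ev g z;
  ev_inj : forall f g : Hsp, (forall z, Om z -> ev f z = ev g z) -> f = g;
  ev_analytic : forall (f : Hsp) (z : CC R), Om z -> derivable (ev f) z 1;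
  ev_bounded : forall z : CC R, Om z -> exists M : CC R, forall f : Hsp,
      `|ev f z| ^+ 2 <= M * inner f f;
  shift_bounded : exists M : CC R, forall f : Hsp, exists g : Hsp,
      (forall z, Om z -> ev g z = z * ev f z) /\ inner g g <= M * inner f f;
  poly_in : forall p : {poly CC R}, exists h : Hsp,
      forall z, Om z -> ev h z = p.[z];
  poly_dense : forall (f : Hsp) (e : CC R), 0 < e ->
      exists (p : {poly CC R}) (h : Hsp),
        (forall z, Om z -> ev h z = p.[z]) /\ inner (f - h) (f - h) < e
}.

Section Defs.
Variables (R : realType) (X : AHS R).
Local Notation C := (CC R).
Local Notation H := (Hsp X).
Local Notation inner := (@inner _ X).
Local Notation ev := (@ev _ X).
Local Notation Om := (Om X).

Definition is_poly_el (h : H) (p : {poly C}) := forall z, Om z -> ev h z = p.[z].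

Definition reproducible (beta : C) (m : nat) :=
  exists L : H -> C,
    (forall (a : C) (f g : H), L (a *: f + g) = a * L f + L g) /\
    (exists M : C, forall f : H, `|L f| ^+ 2 <= M * inner f f) /\
    (forall (h : H) (p : {poly C}), is_poly_el h p -> L h = (p^`(m)).[beta]).

(* k is the representer k_beta^(m): <p, k> = p^(m)(beta) for all polynomials p
   (by density of the polynomials it represents the bounded extension) *)
Definition is_kernel (beta : C) (m : nat) (k : H) :=
  forall (h : H) (p : {poly C}), is_poly_el h p -> inner h k = (p^`(m)).[beta].

Definition kern (beta : C) (m : nat) : H :=
  epsilon (inhabits 0) (is_kernel beta m).

Definition ext_deriv (g : H) (l : nat) (beta : C) : C := inner g (kern beta l).

(* formal determinant D(u; v_1, ..., v_N) expanded along the first column *)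
Definition Dform (u : H) (vs : seq H) : H :=
  let N := size vs in
  let w := fun i : 'I_N.+1 => nth 0 (u :: vs) i in
  let G : 'M[C]_(N.+1, N) := \matrix_(i < N.+1, j < N) inner (w i) (nth 0 vs j) in
  \sum_(i < N.+1) (((-1) ^+ i * \det (row' i G)) *: w i).

End Defs.

(* A finite multiset: 0 with multiplicity rm0, and the points rpts
   (beta_j, m_j). *)
Record fmset (R : realType) := { rm0 : nat; rpts : seq (CC R * nat) }.

Definition mult (R : realType) (Z : fmset R) (beta : CC R) : nat :=
  if beta == 0 then rm0 Z
  else (\sum_(x <- rpts Z | x.1 == beta) x.2)%N.

Section Defs2.
Variables (R : realType) (X : AHS R).
Local Notation C := (CC R).
Local Notation H := (Hsp X).

Definition reproducible_multiset (Z : fmset R) :=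
  uniq (map fst (rpts Z)) /\
  forall x, x \in rpts Z ->
    [/\ x.1 != 0, (1 <= x.2)%N & reproducible X x.1 (x.2 - 1)].

Definition kblock (beta : C) (m : nat) : seq H :=
  [seq kern X beta (m - 1 - i) | i <- iota 0 m].

Definition SS (Z : fmset R) : H :=
  Dform (kern X 0 (rm0 Z))
        (kblock 0 (rm0 Z) ++ flatten [seq kblock x.1 x.2 | x <- rpts Z]).

Definition zero_mult_ge (f : H) (beta : C) (m : nat) : Prop :=
  (Om X beta -> forall l, (l < m)%N -> iter l (fun g => derive1 g) (@ev _ X f) beta = 0) /\
  (~ Om X beta -> m = 0%N \/
     (reproducible X beta (m - 1) /\ forall l, (l < m)%N -> ext_deriv f l beta = 0)).

End Defs2.

(* Main.v *)
Require Import Defs.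
From HB Require Import structures.
From mathcomp Require Import all_boot all_order all_algebra.
From mathcomp Require Import cyclic separable cyclotomic.
From mathcomp Require Import complex.
From mathcomp Require Import all_classical all_reals topology normedtype derive.
From mathcomp Require Import ring lra zify.
From Stdlib Require Import ClassicalEpsilon.
Set Implicit Arguments.
Unset Strict Implicit.
Unset Printing Implicit Defensive.
Import Order.TTheory GRing.Theory Num.Theory.
Import numFieldNormedType.Exports.
Local Open Scope ring_scope.

(** S_A is orthogonal to the kernels of A and equals g u + v, where u is the
kernel k_0^(m_0), v lies in the span of the kernels of A and g is their Gram
determinant; moreover S_A vanishes as soon as they are linearly dependent, which
is the case when g = 0.  The same holds for B, and dependence passes from A to B,
so one may assume g nonzero.  The zeros of S_A make it orthogonal to every kernel
of B.  If B has the same multiplicity at 0 as A, a combination of S_A and S_B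
lies in the span of the kernels of B and is orthogonal to it, hence is 0.  If B
has a higher multiplicity at 0, then u is a kernel of B, so S_A is orthogonal to
itself; then g u + v = 0 is a dependence between kernels of B, and S_B = 0.

At a point of Omega, zeros are read off iterated complex derivatives, and these
must be shown to be inner products with kernels.  Uniform boundedness makes the
point evaluations locally bounded, Cauchy estimates for polynomials, obtained by
averaging over roots of unity, then bound p |-> p^(l)(beta) and its increments in
beta, and both bounds pass from polynomials to H by density. *)

(** * Real-valued modulus and real part of complex numbers *)

Section Modulus.
Variable R : realType.
Local Notation C := (CC R).
Implicit Types z w : C.

(** In [C] the norm is itself a complex number; a modulus in [R] makes real linear arithmetic
    available for estimates. *)
Definition cabs (z : C) : R := complex.Re `|z|.
Definition rc (x : R) : C := real_complex R x.
Definition cre (z : C) : R := complex.Re z.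

Lemma rcD x y : rc (x + y) = rc x + rc y. Proof. exact: rmorphD. Qed.
Lemma rcM x y : rc (x * y) = rc x * rc y. Proof. exact: rmorphM. Qed.
Lemma rcN x : rc (- x) = - rc x. Proof. exact: rmorphN. Qed.
Lemma rc_le x y : (rc x <= rc y) = (x <= y). Proof. exact: lecR. Qed.
Lemma rc_lt x y : (rc x < rc y) = (x < y). Proof. exact: ltcR. Qed.
Lemma rc_ge0 x : (0 <= rc x) = (0 <= x). Proof. exact: ler0c. Qed.
Lemma rc_gt0 x : (0 < rc x) = (0 < x). Proof. exact: (@ltcR _ 0). Qed.
Lemma rc_lt0 x : (rc x < 0) = (x < 0). Proof. exact: (@ltcR _ _ 0). Qed.
Lemma creD z w : cre (z + w) = cre z + cre w. Proof. by case: z w => [a b] [c d]. Qed.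
Lemma creN z : cre (- z) = - cre z. Proof. by case: z. Qed.
Lemma creZ x z : cre (rc x * z) = x * cre z.
Proof. by case: z => [a b]; rewrite /cre /rc /= mul0r subr0. Qed.
Lemma cre_rc x : cre (rc x) = x. Proof. by []. Qed.
Lemma le_cre z w : z <= w -> cre z <= cre w.
Proof. by rewrite lecE => /andP[]. Qed.
Lemma cre_conj z : cre z^* = cre z. Proof. by case: z. Qed.
Lemma rc_conj x : (rc x)^* = rc x.
Proof. by rewrite conj_Creal //; apply/complex_realP; exists x. Qed.
Lemma rc_cre z : 0 <= z -> rc (cre z) = z.
Proof. by move=> z0; apply: RRe_real; apply: ger0_real. Qed.
Lemma rc_cabs z : rc (cabs z) = `|z|.
Proof. exact: (@rc_cre `|z| (normr_ge0 z)). Qed.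
Lemma cabs_ge0 z : 0 <= cabs z. Proof. by rewrite -rc_ge0 rc_cabs. Qed.
Lemma cabsM z w : cabs (z * w) = cabs z * cabs w.
Proof. by apply: complexI; rewrite -!/(rc _) rcM !rc_cabs normrM. Qed.
Lemma cabsX z n : cabs (z ^+ n) = cabs z ^+ n.
Proof. by elim: n => [|n IH]; rewrite ?exprS ?cabsM ?IH // !expr0 /cabs normr1. Qed.
Lemma cabsD z w : cabs (z + w) <= cabs z + cabs w.
Proof. by rewrite -rc_le rcD !rc_cabs ler_normD. Qed.
Lemma cabsN z : cabs (- z) = cabs z. Proof. by rewrite /cabs normrN. Qed.
Lemma cabs0 : cabs 0 = 0. Proof. by rewrite /cabs normr0. Qed.
Lemma cabs1 : cabs 1 = 1. Proof. by rewrite /cabs normr1. Qed.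
Lemma cabs_rc x : cabs (rc x) = `|x|.
Proof.
apply: complexI; rewrite -!/(rc _) rc_cabs.
have [x0|x0] := leP 0 x.
  by rewrite !ger0_norm // rc_ge0.
by rewrite !ltr0_norm ?rc_lt0 // rcN.
Qed.
Lemma cabs_eq0 z : cabs z = 0 -> z = 0.
Proof. by move=> z0; apply/normr0_eq0; rewrite -rc_cabs z0. Qed.
Lemma cabs_sum (I : Type) (r : seq I) (P : pred I) (F : I -> C) :
  cabs (\sum_(i <- r | P i) F i) <= \sum_(i <- r | P i) cabs (F i).
Proof.
elim/big_rec2: _ => [|i x z _ le_zx]; first by rewrite cabs0.
by apply: le_trans (cabsD _ _) _; rewrite lerD2l.
Qed.
Lemma cabs_nat n : cabs n%:R = n%:R.
Proof. by rewrite /cabs normr_nat -[RHS]/(complex.Re (rc n%:R)) /rc rmorph_nat. Qed.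
Lemma cre_le_cabs z : `|cre z| <= cabs z.
Proof. by rewrite -lecR; apply: le_trans (normc_ge_Re z) _; rewrite -/(rc _) rc_cabs. Qed.
Lemma sqr_cabs z : rc (cabs z ^+ 2) = z * z^*.
Proof. by rewrite expr2 rcM rc_cabs -expr2 normCK. Qed.
End Modulus.

(** * Inner product, norm and completeness *)

Section Hilbert.
Variables (R : realType) (X : AHS R).
Local Notation C := (CC R).
Local Notation H := (Hsp X).
Local Notation ip := (@inner _ X).
Implicit Types x y f g h : H.

Lemma ipDl x y z : ip (x + y) z = ip x z + ip y z.
Proof. by have := inner_linl 1 x y z; rewrite scale1r mul1r. Qed.
Lemma ip0l z : ip 0 z = 0.
Proof. by apply: (addrI (ip 0 z)); rewrite -ipDl !addr0. Qed.
Lemma ipZl a x z : ip (a *: x) z = a * ip x z.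
Proof. by have := inner_linl a x 0 z; rewrite addr0 ip0l addr0. Qed.
Lemma ipNl x z : ip (- x) z = - ip x z.
Proof. by rewrite -scaleN1r ipZl mulN1r. Qed.
Lemma ipBl x y z : ip (x - y) z = ip x z - ip y z.
Proof. by rewrite ipDl ipNl. Qed.
Lemma ipDr x y z : ip z (x + y) = ip z x + ip z y.
Proof. by rewrite inner_conj [ip z x]inner_conj [ip z y]inner_conj ipDl rmorphD. Qed.
Lemma ip0r z : ip z 0 = 0.
Proof. by rewrite inner_conj ip0l rmorph0. Qed.
Lemma ipZr a x z : ip z (a *: x) = a^* * ip z x.
Proof. by rewrite inner_conj [ip z x]inner_conj ipZl rmorphM. Qed.
Lemma ipNr x z : ip z (- x) = - ip z x.
Proof. by rewrite inner_conj [ip z x]inner_conj ipNl rmorphN. Qed.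
Lemma ipBr x y z : ip z (x - y) = ip z x - ip z y.
Proof. by rewrite ipDr ipNr. Qed.
Lemma ip_suml (I : Type) (r : seq I) (P : pred I) (F : I -> H) z :
  ip (\sum_(i <- r | P i) F i) z = \sum_(i <- r | P i) ip (F i) z.
Proof. by elim/big_rec2: _ => [|i x y _ <-]; rewrite ?ip0l ?ipDl. Qed.
Lemma ip_sumr (I : Type) (r : seq I) (P : pred I) (F : I -> H) z :
  ip z (\sum_(i <- r | P i) F i) = \sum_(i <- r | P i) ip z (F i).
Proof. by elim/big_rec2: _ => [|i x y _ <-]; rewrite ?ip0r ?ipDr. Qed.

Definition nrm x : R := Num.sqrt (cre (ip x x)).

Lemma cre_ip_ge0 x : 0 <= cre (ip x x).
Proof. by rewrite -rc_ge0 rc_cre ?inner_ge0. Qed.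
Lemma nrm_ge0 x : 0 <= nrm x. Proof. exact: sqrtr_ge0. Qed.
Lemma sqr_nrm x : nrm x ^+ 2 = cre (ip x x).
Proof. by rewrite sqr_sqrtr // cre_ip_ge0. Qed.
Lemma rc_sqr_nrm x : rc (nrm x ^+ 2) = ip x x.
Proof. by rewrite sqr_nrm rc_cre // inner_ge0. Qed.
Lemma nrm_eq0 x : nrm x = 0 -> x = 0.
Proof. by move=> x0; apply: inner_eq0; rewrite -rc_sqr_nrm x0 expr0n. Qed.
Lemma nrm0 : nrm 0 = 0. Proof. by rewrite /nrm ip0l sqrtr0. Qed.

(** Positivity of the squared norm of [ip y y *: x - ip x y *: y], which is [ip y y] times the
    difference of the squared sides. *)
Lemma cauchy_schwarz x y : cabs (ip x y) <= nrm x * nrm y.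
Proof.
have [->|y0] := eqVneq y 0; first by rewrite ip0r cabs0 mulr_ge0 ?nrm_ge0.
have ny : 0 < nrm y.
  rewrite lt_neqAle nrm_ge0 andbT eq_sym; apply/eqP => /nrm_eq0 e.
  by rewrite e eqxx in y0.
suff : cabs (ip x y) ^+ 2 <= (nrm x * nrm y) ^+ 2.
  by rewrite ler_pXn2r // nnegrE ?cabs_ge0 // mulr_ge0 ?nrm_ge0.
have := inner_ge0 (ip y y *: x - ip x y *: y).
rewrite !(ipBl, ipBr, ipZl, ipZr) -!inner_conj.
have -> : ip y y * (ip y y * ip x x) - ip y y * (ip y x * ip x y) -
          (ip x y * (ip y y * ip y x) - ip x y * (ip y x * ip y y)) =
          ip y y * (ip y y * ip x x - ip x y * ip y x) by ring.
rewrite [ip y x]inner_conj -sqr_cabs -!rc_sqr_nrm -!rcM -rcN -rcD -rcM.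
rewrite rc_ge0 pmulr_rge0 ?exprn_gt0 // subr_ge0.
by rewrite exprMn mulrC.
Qed.

Lemma nrmZ a x : nrm (a *: x) = cabs a * nrm x.
Proof.
apply/eqP; rewrite -(eqrXn2 (n := 2)) ?mulr_ge0 ?nrm_ge0 ?cabs_ge0 //.
apply/eqP/complexI; rewrite -!/(rc _) rc_sqr_nrm exprMn rcM sqr_cabs rc_sqr_nrm.
by rewrite ipZl ipZr mulrA.
Qed.
Lemma nrmN x : nrm (- x) = nrm x.
Proof. by rewrite -scaleN1r nrmZ cabsN cabs1 mul1r. Qed.
Lemma sqr_nrmD x y : nrm (x + y) ^+ 2 = nrm x ^+ 2 + 2 * cre (ip x y) + nrm y ^+ 2.
Proof.
rewrite !sqr_nrm ipDl !ipDr !creD [ip y x]inner_conj cre_conj; ring.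
Qed.
Lemma nrmD x y : nrm (x + y) <= nrm x + nrm y.
Proof.
have h : nrm (x + y) ^+ 2 <= (nrm x + nrm y) ^+ 2.
  have := cauchy_schwarz x y; have := cre_le_cabs (ip x y).
  have := ler_norm (cre (ip x y)); rewrite sqr_nrmD; nra.
by move: h; rewrite ler_pXn2r // nnegrE ?nrm_ge0 // addr_ge0 ?nrm_ge0.
Qed.
Lemma nrm_distC x y : nrm (x - y) = nrm (y - x).
Proof. by rewrite -nrmN opprB. Qed.
Lemma nrm_triangle y x z : nrm (x - z) <= nrm (x - y) + nrm (y - z).
Proof. by apply: le_trans (nrmD _ _); rewrite addrA subrK. Qed.

Lemma nrm_complete (u : nat -> H) :
  (forall e : R, 0 < e -> exists N : nat, forall m n : nat,
     (N <= m)%N -> (N <= n)%N -> nrm (u m - u n) < e) ->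
  exists x, forall e : R, 0 < e -> exists N : nat, forall n : nat,
     (N <= n)%N -> nrm (u n - x) < e.
Proof.
have conv (e : R) x : 0 < e -> (ip x x < rc (e ^+ 2)) = (nrm x < e).
  move=> e0; rewrite -rc_sqr_nrm rc_lt ltr_pXn2r // nnegrE ?nrm_ge0 //.
  exact: ltW.
move=> cau; have [|x xP] := @complete _ X u.
  move=> e e0; have ee : e = rc (cre e) by rewrite rc_cre ?ltW.
  have e0' : 0 < cre e by rewrite -rc_gt0 -ee.
  have s0 : 0 < Num.sqrt (cre e) by rewrite sqrtr_gt0.
  have [N NP] := cau _ s0; exists N => m n hm hn.
  by rewrite ee -[cre e]sqr_sqrtr ?ltW // conv //; exact: NP.
exists x => e e0; have e20 : 0 < rc (e ^+ 2) by rewrite rc_gt0 exprn_gt0.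
have [N NP] := xP _ e20.
by exists N => n hn; rewrite -conv //; exact: NP.
Qed.

(** The bounds in [AHS] have complex constants of unspecified sign; comparing real parts turns them
    into real ones. *)
Lemma sqr_bound (z : C) (M : C) x :
  `|z| ^+ 2 <= M * ip x x -> cabs z <= Num.sqrt `|cre M| * nrm x.
Proof.
rewrite -rc_sqr_nrm -rc_cabs [rc _ ^+ 2]expr2 -rcM -expr2 => h.
have {}h : cabs z ^+ 2 <= cre M * nrm x ^+ 2.
  by move/le_cre: h; rewrite [M * _]mulrC creZ mulrC cre_rc.
rewrite -(ler_pXn2r (n := 2)) ?nnegrE ?cabs_ge0 ?mulr_ge0 ?sqrtr_ge0 ?nrm_ge0 //.
rewrite exprMn sqr_sqrtr ?normr_ge0 //; apply: le_trans h _.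
by rewrite ler_wpM2r ?exprn_ge0 ?nrm_ge0 // ler_norm.
Qed.

Lemma ev_nrm_bound (z : C) : Om X z ->
  exists m : R, 0 <= m /\ forall f, cabs (ev f z) <= m * nrm f.
Proof.
move=> /ev_bounded[M MP]; exists (Num.sqrt `|cre M|); split; first exact: sqrtr_ge0.
by move=> f; apply: sqr_bound.
Qed.
End Hilbert.

(** * Cauchy estimates and Taylor remainders for polynomials *)

Section CauchyEstimates.
Variable R : realType.
Local Notation C := (CC R).
Implicit Types (p : {poly C}) (b h : C) (r B : R).

(** ['X^n - 1] splits and is separable in characteristic zero, so it has n distinct roots, among
    which one is primitive. *)
Lemma closed_prim_root_exists n : (0 < n)%N -> exists w : C, n.-primitive_root w.
Proof.
move=> n_gt0; pose p : {poly C} := 'X^n - 1; have [rs Dp] := closed_field_poly_normal p.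
rewrite (monicP _) ?monicXnsubC // scale1r in Dp.
have rn1 : all n.-unity_root rs by apply/allP=> z; rewrite -root_prod_XsubC -Dp.
have sz_r : (n < (size rs).+1)%N.
  by rewrite -(size_prod_XsubC rs id) -Dp size_XnsubC.
have [|z] := hasP (has_prim_root n_gt0 rn1 _ sz_r); last by exists z.
by rewrite -separable_prod_XsubC -Dp separable_Xn_sub_1 // pnatr_eq0 -lt0n.
Qed.

Lemma cabs_prim_root n (w : C) : n.-primitive_root w -> cabs w = 1.
Proof.
move=> wP; have n0 := prim_order_gt0 wP.
apply/eqP; rewrite -(pexpr_eq1 n0) ?cabs_ge0 //.
by rewrite -cabsX (prim_expr_order wP) cabs1.
Qed.

Lemma sum_prim_root n (w : C) k : n.-primitive_root w ->
  \sum_(j < n) (w ^+ k) ^+ j = if (n %| k)%N then n%:R else 0.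
Proof.
move=> wP; rewrite (prim_order_dvd wP); case: eqP => [->|/eqP k1].
  by under eq_bigr do rewrite expr1n; rewrite sumr_const card_ord.
have := subrX1 (w ^+ k) n; rewrite exprAC (prim_expr_order wP) expr1n subrr.
by move=> /esym/eqP; rewrite mulf_eq0 subr_eq0 (negPf k1) => /eqP.
Qed.

(* Averaging p over the circle against a power of a root of unity of order
   exceeding the degree isolates one Taylor coefficient exactly: this is
   Cauchy's formula for polynomials, with no integral. *)
Lemma nderivn_cauchy p b r B l : 0 <= r ->
  (forall h, cabs h = r -> cabs p.[b + h] <= B) ->
  cabs (p^`N(l)).[b] * r ^+ l <= B.
Proof.
(* The order n exceeds the degree, so n Taylor terms suffice, and exceeds l, so [w ^+ (n - l)] acts
   as the inverse of [w ^+ l]. *)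
move=> r0 pB; pose n := (size p + l).+1.
have [w wP] := @closed_prim_root_exists n isT.
pose S := \sum_(j < n) w ^+ (j * (n - l)) * p.[b + rc r * w ^+ j].
have SE : S = n%:R * ((p^`N(l)).[b] * rc r ^+ l).
  have -> : S = \sum_(i < n) (p^`N(i)).[b] * rc r ^+ i *
                \sum_(j < n) (w ^+ (n - l + i)) ^+ j.
    under [RHS]eq_bigr do rewrite mulr_sumr.
    rewrite exchange_big; apply: eq_bigr => j _.
    rewrite (@nderiv_taylor_wide _ n); [|exact: mulrC|by rewrite /n; lia].
    rewrite mulr_sumr; apply: eq_bigr => i _.
    by rewrite exprMn -!exprM mulnDl exprD -![(_ * j)%N]mulnC; ring.
  have ln : (l < n)%N by rewrite /n; lia.
  rewrite (bigD1 (Ordinal ln)) //= [X in _ + X]big1 => [|i il]; last first.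
    (* Since [n - l + i] lies strictly between 0 and 2n, n divides it only when i = l. *)
    rewrite sum_prim_root //; case: ifP; last by rewrite mulr0.
    move=> /dvdnP[q hq]; case/eqP: il; apply: val_inj => /=.
    have := ltn_ord i; case: q hq => [|[|q]] hq; [lia|lia|].
    by move: hq; rewrite !mulSn; lia.
  by rewrite sum_prim_root // subnK 1?ltnW // dvdnn addr0 mulrC.
have n0 : 0 < n%:R :> R by rewrite ltr0n.
have : cabs S <= n%:R * B.
  apply: le_trans (cabs_sum _ _ _) _.
  rewrite mulr_natl -[in leRHS](card_ord n) -sumr_const; apply: ler_sum => j _.
  rewrite cabsM cabsX (cabs_prim_root wP) expr1n mul1r; apply: pB.
  by rewrite cabsM cabs_rc cabsX (cabs_prim_root wP) expr1n mulr1 ger0_norm.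
by rewrite SE !cabsM cabs_nat cabsX cabs_rc ger0_norm // ler_pM2l.
Qed.

Lemma derivn_cauchy p b r B l : 0 < r ->
  (forall h, cabs h = r -> cabs p.[b + h] <= B) ->
  cabs (p^`(l)).[b] <= l`!%:R * B / r ^+ l.
Proof.
move=> r0 /(nderivn_cauchy l (ltW r0)).
rewrite ler_pdivlMr ?exprn_gt0 // nderivn_def hornerMn -mulr_natl cabsM cabs_nat.
by rewrite -mulrA; apply: ler_wpM2l; rewrite ler0n.
Qed.

Lemma sum_half_le n : \sum_(i < n) (2^-1 : R) ^+ i <= 2.
Proof.
suff -> : \sum_(i < n) (2^-1 : R) ^+ i = 2 - 2 * 2^-1 ^+ n.
  by rewrite gerBl mulr_ge0 // exprn_ge0 // invr_ge0.
elim: n => [|n IH]; first by rewrite big_ord0 expr0 mulr1 subrr.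
by rewrite big_ord_recr IH /= exprS; field.
Qed.

(** The i-th Taylor coefficient is at most [B / r ^+ i], so the terms from order 2 on are dominated
    by a geometric series of ratio at most one half. *)
Lemma taylor_order2 p b h r B : 0 < r -> 0 <= B ->
  (forall h, cabs h = r -> cabs p.[b + h] <= B) -> cabs h <= r / 2 ->
  cabs (p.[b + h] - p.[b] - h * (p^`()).[b]) <= 2 * B / r ^+ 2 * cabs h ^+ 2.
Proof.
move=> r0 B0 pB hr.
rewrite (@nderiv_taylor_wide _ (size p).+2); [|exact: mulrC|by lia].
rewrite 2!big_ord_recl /= /bump /= nderivn0 nderivn1 expr0 mulr1 expr1.
set T := \sum_(i < _) _.
have -> : p.[b] + (p^`().[b] * h + T) - p.[b] - h * p^`().[b] = T by ring.
apply: le_trans (cabs_sum _ _ _) _.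
have q0 : 0 <= cabs h / r by rewrite divr_ge0 ?cabs_ge0 ?ltW.
apply: (@le_trans _ _ (\sum_(i < size p) B * (cabs h / r) ^+ 2 * 2^-1 ^+ i)).
  apply: ler_sum => i _; rewrite cabsM cabsX.
  have := nderivn_cauchy (bump 0 (bump 0 i)) (ltW r0) pB.
  rewrite /bump /= -ler_pdivlMr ?exprn_gt0 // => hN.
  apply: (@le_trans _ _ (B / r ^+ (1 + (1 + i)) * cabs h ^+ (1 + (1 + i)))).
    by rewrite ler_wpM2r ?exprn_ge0 ?cabs_ge0.
  rewrite mulrAC -mulrA -expr_div_n !addnA exprD mulrA.
  apply: ler_wpM2l; first by rewrite mulr_ge0 // exprn_ge0.
  apply: lerXn2r; rewrite ?nnegrE ?invr_ge0 //.
  by rewrite ler_pdivrMr // mulrC.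
rewrite -mulr_sumr (_ : 2 * B / r ^+ 2 * cabs h ^+ 2 = B * (cabs h / r) ^+ 2 * 2).
  by apply: ler_wpM2l (sum_half_le _); rewrite mulr_ge0 // exprn_ge0.
by rewrite expr_div_n; ring.
Qed.

(** [taylor_order2] is applied to the l-th derivative, itself bounded on the circle of radius r by
    Cauchy estimates on circles of radius r; hence the disc of radius 2r. *)
Lemma derivn_increment p b h r B l : 0 < r -> 0 <= B ->
  (forall z, cabs (z - b) <= 2 * r -> cabs p.[z] <= B) -> cabs h <= r / 2 ->
  cabs ((p^`(l)).[b + h] - (p^`(l)).[b] - h * (p^`(l.+1)).[b])
    <= 2 * (l`!%:R * B / r ^+ l) / r ^+ 2 * cabs h ^+ 2.
Proof.
move=> r0 B0 pB hr; rewrite derivnS; apply: taylor_order2 => //.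
  by rewrite divr_ge0 ?exprn_ge0 ?(ltW r0) // mulr_ge0 ?ler0n.
move=> u ur; apply: derivn_cauchy => // v vr; apply: pB.
have -> : b + u + v - b = u + v by ring.
by apply: le_trans (cabsD _ _) _; rewrite ur vr; lra.
Qed.
End CauchyEstimates.

(** * Formal determinants, Gram matrices and linear dependence *)

Section FormalDeterminant.
Variables (R : realType) (X : AHS R).
Local Notation C := (CC R).
Local Notation H := (Hsp X).
Local Notation ip := (@inner _ X).
Implicit Types (u v : H) (vs : seq H).

Definition gram vs : 'M[C]_(size vs) := \matrix_(i, j) ip vs`_i vs`_j.

Lemma Dform_orth u vs j : (j < size vs)%N -> ip (Dform u vs) vs`_j = 0.
Proof.
move=> jN; rewrite /Dform; set G := (\matrix_(_, _) _).
(* Pairing with the j-th vector turns the first column into a copy of the j-th Gram column, so the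
   determinant has two equal columns. *)
pose A : 'M[C]_((size vs).+1) :=
  \matrix_(i, k) if unlift ord0 k is Some k' then G i k' else G i (Ordinal jN).
have colA : col' ord0 A = G by apply/matrixP => i k; rewrite !mxE liftK mxE.
transitivity (\det A).
  rewrite (expand_det_col A ord0) ip_suml; apply: eq_bigr => i _.
  rewrite ipZl /cofactor addn0 colA mulrC; congr (_ * _).
  by rewrite mxE unlift_none mxE.
rewrite -det_tr (determinant_alternate (i1 := ord0) (i2 := lift ord0 (Ordinal jN))) //.
by move=> i; rewrite !mxE unlift_none liftK !mxE.
Qed.

Lemma Dform_expand u vs : exists c : nat -> C,
  Dform u vs = \det (gram vs) *: u + \sum_(i < size vs) c i *: vs`_i.
Proof.
rewrite /Dform; set G := (\matrix_(_, _) _).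
exists (fun i => if insub i.+1 is Some k then (-1) ^+ i.+1 * \det (row' (k : 'I__) G) else 0).
rewrite big_ord_recl /= expr0 mul1r; congr (\det _ *: _ + _).
  by apply/matrixP => i k; rewrite !mxE.
apply: eq_bigr => i _; congr (_ *: _).
have := valK (lift ord0 i : 'I_(size vs).+1).
by rewrite /= /bump /= => ->.
Qed.

(** Deleting a row keeps every column relation, so a dependence among the vectors annihilates all
    the minors at once. *)
Lemma Dform_dependent u vs (c : nat -> C) (j : nat) : (j < size vs)%N -> c j != 0 ->
  \sum_(i < size vs) c i *: vs`_i = 0 -> Dform u vs = 0.
Proof.
move=> jN cj0 c0; rewrite /Dform big1 // => i _.
set G := (\matrix_(_, _) _).
suff -> : \det (row' i G) = 0 by rewrite mulr0 scale0r.
apply/eqP; rewrite -det_tr; apply/det0P.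
(* Columns depend on the second, conjugate-linear argument of the inner product. *)
exists (\row_(k < size vs) (c k)^*).
  apply/eqP => /matrixP/(_ ord0 (Ordinal jN)); rewrite !mxE /= => /eqP.
  by rewrite conjC_eq0 (negPf cj0).
apply/matrixP => a b; rewrite !mxE.
rewrite -[RHS](ip0r (nth 0 (u :: vs) (lift i b))) -[X in _ = ip _ X]c0 ip_sumr.
by apply: eq_bigr => k _; rewrite !mxE ipZr.
Qed.

(** A left null vector of the Gram matrix gives a combination orthogonal to every vector of the
    list, hence to itself. *)
Lemma gram_det0 vs : \det (gram vs) = 0 -> exists (c : nat -> C) (j : nat),
  [/\ (j < size vs)%N, c j != 0 & \sum_(i < size vs) c i *: vs`_i = 0].
Proof.
move/eqP/det0P => [w w0 wG].
pose c k := if insub k is Some i then w ord0 i else 0.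
have cE (i : 'I_(size vs)) : c i = w ord0 i by rewrite /c valK.
have [j wj] : exists j, w ord0 j != 0.
  apply/existsP; apply: contraNT w0; rewrite negb_exists => /forallP w0.
  by apply/eqP/matrixP => a b; rewrite ord1 mxE; apply/eqP; have := w0 b; rewrite negbK.
exists c, j; split; rewrite ?ltn_ord ?cE //.
apply: inner_eq0; rewrite ip_sumr big1 // => k _; rewrite ipZr ip_suml.
move/matrixP/(_ ord0 k): wG; rewrite !mxE => wG.
suff -> : \sum_(i < size vs) ip (c i *: vs`_i) vs`_k = 0 by rewrite mulr0.
by apply: etrans wG; apply: eq_bigr => i _; rewrite mxE ipZl cE.
Qed.

Variables (J : eqType) (F : J -> H).
Implicit Types (s t : seq J).

(** Coefficients are attached to indices, so equal vectors at distinct indices of a duplicate-free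
    list count as dependent. *)
Definition lindep s := exists c : J -> C,
  (exists2 x, x \in s & c x != 0) /\ \sum_(x <- s) c x *: F x = 0.

Lemma big_map_nth s (c : nat -> C) : uniq s ->
  \sum_(i < size (map F s)) c i *: (map F s)`_i =
  \sum_(x <- s) c (index x s) *: F x.
Proof.
case: s => [|x0 s]; first by rewrite big_ord0 big_nil.
move=> us; rewrite [RHS](big_nth x0) big_mkord size_map.
by apply: eq_bigr => i _; rewrite index_uniq // (nth_map x0).
Qed.

Lemma lindep_subset s t : uniq s -> uniq t -> {subset s <= t} -> lindep s -> lindep t.
Proof.
move=> us ut st [c [[x xs cx] c0]].
exists (fun x => if x \in s then c x else 0); split.
  by exists x; [exact: st | rewrite xs].
rewrite -[RHS]c0 (bigID (mem s)) /= [X in _ + X]big1 ?addr0 => [|y /negPf->]; last first.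
  by rewrite scale0r.
rewrite -big_filter (perm_big s) /=.
  by apply: eq_big_seq => y ys; rewrite ys.
apply: uniq_perm; rewrite ?filter_uniq // => y.
by rewrite mem_filter andbC; case: (boolP (y \in s)) => [/st->|]; rewrite ?andbF.
Qed.

Lemma Dform_lindep u s : uniq s -> lindep s -> Dform u (map F s) = 0.
Proof.
move=> us [c [[x xs cx] c0]].
apply: (@Dform_dependent _ _ (fun i => c (nth x s i)) (index x s)).
- by rewrite size_map index_mem.
- by rewrite nth_index.
rewrite (@big_map_nth s (fun i => c (nth x s i))) // -[RHS]c0; apply: eq_big_seq => y ys.
by rewrite nth_index.
Qed.

Lemma gram_lindep s : uniq s -> \det (gram (map F s)) = 0 -> lindep s.
Proof.
move=> us /gram_det0[c [j [js cj]]]; rewrite big_map_nth // => c0.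
rewrite size_map in js; exists (fun x => c (index x s)); split => //.
case: s us js c0 => // x0 s us js _; exists (nth x0 (x0 :: s) j).
  by rewrite mem_nth.
by rewrite index_uniq.
Qed.

Lemma Dform_expand_map u s : uniq s -> exists c : J -> C,
  Dform u (map F s) = \det (gram (map F s)) *: u + \sum_(x <- s) c x *: F x.
Proof.
move=> us; have [c ->] := Dform_expand u (map F s).
by exists (fun x => c (index x s)); rewrite big_map_nth.
Qed.

Lemma Dform_orth_map u s x : x \in s -> ip (Dform u (map F s)) (F x) = 0.
Proof.
move=> xs; have := @Dform_orth u (map F s) (index x s).
by rewrite size_map index_mem (nth_map x) ?index_mem // nth_index //; exact.
Qed.

(* The two alternatives for [b] are the two ways to enlarge a multiset: the
   multiplicity of the origin is unchanged, or it grows and the old leading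
   vector joins the family. *)
Lemma Dform_enlarge s t (a b : J) : uniq s -> uniq t -> {subset s <= t} ->
  a \notin s -> b = a \/ a \in t ->
  (forall x, x \in t -> ip (Dform (F a) (map F s)) (F x) = 0) ->
  exists c, Dform (F b) (map F t) = c *: Dform (F a) (map F s).
Proof.
move=> us ut st as_ ab orth.
have dep0 : lindep t -> exists c, Dform (F b) (map F t) = c *: Dform (F a) (map F s).
  by move=> dt; exists 0; rewrite scale0r Dform_lindep.
have [d0|/eqP d0] := eqVneq (\det (gram (map F s))) 0.
  by apply: dep0; apply: lindep_subset (gram_lindep us d0).
have [c Ec] := Dform_expand_map (F a) us.
case: ab => [->|at_].
  have [e Ee] := Dform_expand_map (F a) ut.
  (* The ratio of the coefficients of [F a] in the two expansions, so that [F a] cancels in the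
     difference [w]. *)
  exists (\det (gram (map F t)) / \det (gram (map F s))).
  set ds := \det _ in d0 Ec *; set dt := \det _ in Ee *.
  set S := Dform _ _ in Ec orth *; set T := Dform _ _ in Ee *.
  apply/eqP; rewrite -subr_eq0; apply/eqP/inner_eq0; set w := T - _.
  have wF x : x \in t -> ip w (F x) = 0.
    by move=> xt; rewrite ipBl ipZl orth // Dform_orth_map // mulr0 subr0.
  have wE : w = \sum_(x <- t) e x *: F x - (dt / ds) *: \sum_(x <- s) c x *: F x.
    rewrite /w Ec Ee scalerDr scalerA divfK ?opprD; last exact/eqP.
    by rewrite addrACA subrr add0r.
  rewrite {2}wE ipBr ipZr !ip_sumr !big_seq !big1 ?mulr0 ?subrr // => x xt.
    by rewrite ipZr wF ?mulr0 // st.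
  by rewrite ipZr wF ?mulr0.
apply: dep0; apply: (@lindep_subset (a :: s)) => /=; rewrite ?as_ //.
  by move=> x; rewrite inE => /predU1P[->|/st].
(* These are the coefficients of the expansion of [Dform (F a) (map F s)]; the one at [a] is the
   nonzero Gram determinant. *)
exists (fun x => if x == a then \det (gram (map F s)) else c x); split.
  by exists a; [exact: mem_head | rewrite eqxx; exact/eqP].
rewrite big_cons eqxx.
have -> : \sum_(j <- s) (if j == a then \det (gram (map F s)) else c j) *: F j =
          \sum_(j <- s) c j *: F j.
  apply: eq_big_seq => x xs; case: eqP => // xa; by rewrite -xa xs in as_.
rewrite -Ec; apply: inner_eq0; rewrite {2}Ec ipDr ipZr orth // mulr0 add0r.
by rewrite ip_sumr big_seq big1 // => x xs; rewrite ipZr orth ?mulr0 // st.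
Qed.
End FormalDeterminant.

(** * Uniform boundedness and Riesz representation *)

Section FunctionalAnalysis.
Variables (R : realType) (X : AHS R).
Local Notation C := (CC R).
Local Notation H := (Hsp X).
Local Notation ip := (@inner _ X).

Lemma invr_nat_lt (e : R) : 0 < e -> exists N : nat, forall n, (N <= n)%N -> n.+1%:R^-1 < e.
Proof.
move=> e0; exists (Num.bound e^-1) => n Nn.
rewrite -[ltRHS]invrK ltf_pV2 ?posrE ?invr_gt0 ?ltr0n //.
have := archi_boundP (ltW (_ : 0 < e^-1)); rewrite invr_gt0 => /(_ e0) h.
by apply: lt_le_trans h _; rewrite ler_nat; lia.
Qed.

(* Baire's argument with explicit nested balls. The index set shrinks along
   [W], and both hypothesis and conclusion are required only eventually. *)
Lemma uniform_boundedness (I : Type) (W : nat -> I -> Prop) (L : I -> H -> C) :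
  (forall m n i, (m <= n)%N -> W n i -> W m i) ->
  (forall i, W 0%N i -> (forall (a : C) f g, L i (a *: f + g) = a * L i f + L i g) /\
     exists m : R, 0 <= m /\ forall f, cabs (L i f) <= m * nrm f) ->
  (forall f, exists n (B : R), forall i, W n i -> cabs (L i f) <= B) ->
  exists n (M : R), 0 <= M /\ forall i, W n i -> forall f, cabs (L i f) <= M * nrm f.
Proof.
move=> Wdec Llin Lpt; apply: contrapT => neg.
have big (n : nat) (M : R) : 0 <= M ->
    exists i f, W n i /\ M * nrm f < cabs (L i f).
  move=> M0; apply: contrapT => h; apply: neg; exists n, M; split=> // i Wi f.
  by rewrite leNgt; apply/negP => lt; apply: h; exists i, f.
(* A pair is a centre and a radius. Positivity is assumed inside the existential, with a dummy ball
   otherwise, so that choice yields a total function. *)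
have step (p : nat * (H * R)) : exists q : H * R, 0 < p.2.2 ->
    [/\ 0 < q.2, q.2 <= p.1.+1%:R^-1, nrm (q.1 - p.2.1) + q.2 <= p.2.2 &
     exists i, W p.1 i /\ forall y, nrm (y - q.1) <= q.2 -> p.1%:R <= cabs (L i y)].
  case: p => k [x r] /=; have [r0|_] := ltP 0 r; last by exists (0, 0).
  (* With this threshold, rescaling f to norm r / 2 gives a vector g on which the functional exceeds
     k + 1. *)
  have [|i [f [Wi lt]]] := big k (2 * k.+1%:R / r).
    by rewrite divr_ge0 ?mulr_ge0 ?ler0n ?ltW.
  have [lin [m [m0 mP]]] := Llin i (Wdec 0%N k i (leq0n _) Wi).
  have LD u v : L i (u + v) = L i u + L i v.
    by have := lin 1 u v; rewrite scale1r mul1r.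
  have L0 : L i 0 = 0 by apply: (addrI (L i 0)); rewrite -LD !addr0.
  have LZ a u : L i (a *: u) = a * L i u.
    by have := lin a u 0; rewrite addr0 L0 addr0.
  have nf : 0 < nrm f.
    rewrite lt_neqAle nrm_ge0 andbT eq_sym; apply/eqP => /nrm_eq0 f0.
    by move: lt; rewrite f0 L0 cabs0 nrm0 mulr0 ltxx.
  pose g := rc (r / 2 / nrm f) *: f.
  have ng : nrm g = r / 2.
    rewrite nrmZ cabs_rc ger0_norm ?divfK ?gt_eqF //.
    by rewrite !divr_ge0 ?ltW.
  have Lg : k.+1%:R < cabs (L i g).
    rewrite LZ cabsM cabs_rc ger0_norm; last by rewrite !divr_ge0 ?ltW.
    rewrite mulrC mulrA ltr_pdivlMr //.
    have : 2 * k.+1%:R / r * nrm f * (r / 2) < cabs (L i f) * (r / 2).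
      by rewrite ltr_pM2r // divr_gt0.
    by congr (_ < _); field; rewrite gt_eqF.
  (* Since [2 * L i g] is the difference of the values at [x + g] and [x - g], one of these two
     values is large. *)
  have [x' [nx Lx']] : exists x', nrm (x' - x) = r / 2 /\ k.+1%:R < cabs (L i x').
    have [lt1|le1] := ltP k.+1%:R (cabs (L i (x + g))).
      by exists (x + g); rewrite addrAC subrr add0r.
    exists (x - g); split; first by rewrite addrAC subrr add0r nrmN.
    have e : 2 * L i g = L i (x + g) - L i (x - g).
      by rewrite !LD -[- g]scaleN1r (LZ (-1) g); ring.
    have := cabsD (L i (x + g)) (- L i (x - g)).
    rewrite -e cabsN cabsM cabs_nat; lra.
  (* The three bounds nest the balls, send the radii to 0, and let [L i] vary by at most 1 on the
     new ball. *)
  pose r' := Num.min (r / 2) (Num.min k.+1%:R^-1 (m + 1)^-1).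
  have m1 : 0 < m + 1 by lra.
  have r'1 : r' <= r / 2 by rewrite ge_min lexx.
  have r'2 : r' <= k.+1%:R^-1 by rewrite !ge_min lexx orbT.
  have r'3 : r' <= (m + 1)^-1 by rewrite !ge_min lexx !orbT.
  have r'0 : 0 < r' by rewrite !lt_min !invr_gt0 m1 ltr0n divr_gt0.
  exists (x', r') => _ /=; split=> //; first by rewrite nx; lra.
  exists i; split=> // y ny.
  have e : L i x' = L i y + L i (x' - y) by rewrite -LD addrC subrK.
  have := cabsD (L i y) (L i (x' - y)); rewrite -e.
  have := mP (x' - y); rewrite nrm_distC.
  have : m * nrm (y - x') <= 1.
    apply: (@le_trans _ _ (m * (m + 1)^-1)); first by rewrite ler_wpM2l // (le_trans ny).
    by rewrite ler_pdivrMr //; lra.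
  move: Lx'; rewrite -natr1; lra.
have {step}[G GP] := boolp.choice step.
pose s := fix s n := if n is k.+1 then G (k, s k) else (0 : H, 1 : R).
have sS n : s n.+1 = G (n, s n) by [].
have s00 : 0 < (s 0%N).2 by exact: ltr01.
clearbody s; have s0 n : 0 < (s n).2.
  elim: n => [//|n IH].
  by rewrite sS; case: (GP (n, s n) IH).
have sP n := GP (n, s n) (s0 n).
have nest n k : nrm ((s (k + n)%N).1 - (s n).1) + (s (k + n)%N).2 <= (s n).2.
  elim: k => [|k IH]; first by rewrite add0n subrr nrm0 add0r.
  case: (sP (k + n)%N) => _ _ h _; rewrite -sS /= in h.
  have := nrm_triangle (s (k + n)%N).1 (s (k.+1 + n)%N).1 (s n).1.
  by rewrite addSn; lra.
have near n k : (n <= k)%N -> nrm ((s k).1 - (s n).1) <= (s n).2.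
  by move=> /subnK <-; have := nest n (k - n)%N; have := s0 (k - n + n)%N; lra.
have small n : (s n.+1).2 <= n.+1%:R^-1 by rewrite sS; case: (sP n).
have [x xP] : exists x, forall e : R, 0 < e -> exists N : nat, forall n : nat,
     (N <= n)%N -> nrm ((s n).1 - x) < e.
  apply: (@nrm_complete _ _ (fun n => (s n).1)) => e e0.
  have e20 : 0 < e / 2 by rewrite divr_gt0.
  have [N NP] := invr_nat_lt e20.
  exists N.+1 => m n hm hn.
  have := nrm_triangle (s N.+1).1 (s m).1 (s n).1; rewrite (nrm_distC (s N.+1).1).
  have := near _ _ hm; have := near _ _ hn; have := small N.
  have := NP _ (leqnn N). set q := _^-1; lra.
have xball n : nrm (x - (s n).1) <= (s n).2.
  rewrite leNgt; apply/negP => lt.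
  have [|N NP] := xP (nrm (x - (s n).1) - (s n).2); first by lra.
  have := NP _ (leq_maxl N n); have := near _ _ (leq_maxr N n).
  have := nrm_triangle (s (maxn N n)).1 x (s n).1.
  rewrite [nrm (x - (s (maxn _ _)).1)]nrm_distC; lra.
have [n [B BP]] := Lpt x.
(* Stage k gives an index in [W n] whose functional at x is at least k, which exceeds B. *)
pose k := maxn n (Num.bound `|B|).
have [_ _ _ [i [Wi iP]]] := sP k.
have := iP x; rewrite -sS => /(_ (xball _)).
have := BP i (Wdec _ _ _ (leq_maxl _ _) Wi).
have h : `|B| < k%:R.
  by apply: lt_le_trans (archi_boundP (normr_ge0 B)) _; rewrite ler_nat leq_maxr.
have := ler_norm B; move: h => /=; lra.
Qed.

(** The functional lives on [T], mapped into [H] by [j], so that one defined only on polynomials is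
    represented without first being extended. *)
Lemma riesz_representation (T : lmodType C) (j : T -> H) (L : T -> C) (m : R) :
  (forall a x y, j (a *: x + y) = a *: j x + j y) ->
  (forall a x y, L (a *: x + y) = a * L x + L y) ->
  (forall t, cabs (L t) <= m * nrm (j t)) ->
  exists k : H, forall t, L t = ip (j t) k.
Proof.
move=> jlin Llin LB.
have jD x y : j (x + y) = j x + j y by have := jlin 1 x y; rewrite !scale1r.
have LD x y : L (x + y) = L x + L y by have := Llin 1 x y; rewrite scale1r mul1r.
have j0 : j 0 = 0 by apply: (addrI (j 0)); rewrite -jD !addr0.
have L0 : L 0 = 0 by apply: (addrI (L 0)); rewrite -LD !addr0.
have jZ a x : j (a *: x) = a *: j x by have := jlin a x 0; rewrite j0 !addr0.
have LZ a x : L (a *: x) = a * L x by have := Llin a x 0; rewrite L0 !addr0.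
(* The representer minimizes Phi over the closure of the range of j. *)
pose Phi t := nrm (j t) ^+ 2 - 2 * cre (L t).
pose E : set R := [set r | exists t, r = Phi t]%classic.
have Einf : has_inf E.
  split; first by exists (Phi 0); exists 0.
  exists (- m ^+ 2) => _ [t ->]; rewrite /Phi.
  have := LB t; have := cre_le_cabs (L t); have := ler_norm (cre (L t)).
  have := sqr_ge0 (nrm (j t) - m); rewrite sqrrB; lra.
set d := inf E; have dle t : d <= Phi t by apply: (ge_inf (proj2 Einf)); exists t.
have ex n : exists u, Phi u < d + n.+1%:R^-1.
  have [|_ [t ->] lt] := @inf_adherent _ E n.+1%:R^-1 _ Einf.
    by rewrite invr_gt0 ltr0n.
  by exists t.
have {ex}[t tP] := boolp.choice ex.
(* The parallelogram law together with [d <= Phi] at the midpoint; it makes minimizing sequences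
   Cauchy. *)
have par u v : nrm (j u - j v) ^+ 2 <= 2 * (Phi u - d) + 2 * (Phi v - d).
  have := dle (rc 2^-1 *: (u + v)); rewrite /Phi jZ LZ creZ LD creD jD nrmZ.
  rewrite cabs_rc ger0_norm ?invr_ge0 // exprMn sqr_nrmD.
  rewrite sqr_nrmD nrmN ipNr creN; lra.
have [x xP] : exists x, forall e : R, 0 < e -> exists N : nat, forall n : nat,
     (N <= n)%N -> nrm (j (t n) - x) < e.
  apply: (@nrm_complete _ _ (fun n => j (t n))) => e e0.
  have e20 : 0 < e ^+ 2 / 4 by rewrite divr_gt0 ?exprn_gt0.
  have [N NP] := invr_nat_lt e20.
  exists N => p q hp hq; rewrite -(ltr_pXn2r (n := 2)) ?nnegrE ?nrm_ge0 ?ltW //.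
  have := par (t p) (t q); have := NP _ hp; have := NP _ hq.
  have := tP p; have := tP q.
  by move: (p.+1%:R^-1) (q.+1%:R^-1) => z1 z2; lra.
have re h : cre (ip x (j h)) = cre (L h).
  apply/eqP; rewrite -subr_eq0; apply/eqP; set a := _ - _.
  set b := nrm (j h).
  (* First variation: a near-minimizer is moved by [eps] along h, and [eta] absorbs its distance to
     x and its excess over d. *)
  have ineq (eps eta : R) : 0 < eta ->
      0 <= 2 * eps * a + eps ^+ 2 * b ^+ 2 + eta + 2 * `|eps| * (eta * b).
    move=> eta0; have [N NP] := xP _ eta0; have [N' NP'] := invr_nat_lt eta0.
    pose n := maxn N N'; have := NP _ (leq_maxl _ _ : (N <= n)%N).
    have := NP' _ (leq_maxr _ _ : (N' <= n)%N); have := tP n.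
    have := dle (t n + rc eps *: h); rewrite /Phi jD jZ LD LZ creD creZ sqr_nrmD.
    rewrite nrmZ cabs_rc exprMn real_normK ?num_real // ipZr rc_conj creZ -/b.
    set y := j (t n) => h1 h2 h3 h4.
    have : eps * cre (ip y (j h)) <= eps * cre (ip x (j h)) + `|eps| * (eta * b).
      rewrite -lerBlDl -mulrBr -creN -creD -ipNl -ipDl.
      apply: le_trans (ler_norm _) _; rewrite normrM ler_wpM2l //.
      apply: le_trans (cre_le_cabs _) _; apply: le_trans (cauchy_schwarz _ _) _.
      by rewrite ler_wpM2r ?nrm_ge0 // ltW.
    by rewrite /a; move: (n.+1%:R^-1) h2 h3 => z1; lra.
  apply/eqP; apply: contraT => a0.
  have b0 : 0 <= b := nrm_ge0 _.
  have b1 : 0 < b ^+ 2 + 1 by rewrite ltr_pwDr // sqr_ge0.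
  (* Near the minimizer of the quadratic in [eps], with 1 added since b may vanish; the quadratic
     part is then below [- de], and the [eta] terms sum to [de / 2]. *)
  pose eps := - a / (b ^+ 2 + 1); pose de := a ^+ 2 / (b ^+ 2 + 1).
  have de0 : 0 < de by rewrite divr_gt0 // exprn_even_gt0.
  have c0 : 0 < 1 + 2 * `|eps| * b by rewrite ltr_pwDl // !mulr_ge0.
  have eta0 : 0 < de / 2 / (1 + 2 * `|eps| * b).
    by apply: divr_gt0 => //; apply: divr_gt0.
  have := ineq eps _ eta0.
  set eta := de / 2 / _.
  have -> : 2 * eps * a + eps ^+ 2 * b ^+ 2 + eta + 2 * `|eps| * (eta * b) =
            2 * eps * a + eps ^+ 2 * b ^+ 2 + eta * (1 + 2 * `|eps| * b) by ring.
  rewrite /eta divfK ?gt_eqF //.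
  have -> : 2 * eps * a + eps ^+ 2 * b ^+ 2 = - de - de / (b ^+ 2 + 1).
    by rewrite /eps /de; field; rewrite gt_eqF.
  have : 0 < de / (b ^+ 2 + 1) by rewrite divr_gt0.
  lra.
have re' h : cre (ip (j h) x) = cre (L h) by rewrite inner_conj cre_conj.
exists x => h; apply/eqP; rewrite eq_sym -subr_eq0; apply/eqP.
(* Testing on i times h recovers the imaginary parts. *)
have := re' h; have := re' ((Complex 0 1 : C) *: h).
rewrite jZ ipZl LZ; case: (ip _ _) => a b; case: (L h) => a' b'.
rewrite /cre /= !mul0r !mul1r !sub0r => /oppr_inj -> ->.
by rewrite subrr.
Qed.
End FunctionalAnalysis.

(** * Neighbourhoods and complex derivatives through the real modulus *)

Section ComplexTopology.
Variable R : realType.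
Local Notation C := (CC R).

Lemma nbhs_cabs (b : C) (A : set C) : nbhs b A ->
  exists r : R, 0 < r /\ forall z, cabs (z - b) < r -> A z.
Proof.
move=> /nbhs_ballP[e /= e0 sub]; exists (cre e); split.
  by rewrite -rc_gt0 rc_cre // ltW.
move=> z; rewrite -rc_lt rc_cabs rc_cre ?ltW // => lt; apply: sub.
by rewrite /ball /= distrC.
Qed.

Lemma derivable_continuous_cabs (F : C -> C) (b : C) (e : R) :
  derivable F b 1 -> 0 < e ->
  exists r : R, 0 < r /\ forall z, cabs (z - b) < r -> cabs (F z - F b) < e.
Proof.
move=> /derivable1_diffP/differentiable_continuous cF e0.
have e0' : 0 < rc e by rewrite rc_gt0.
have [r [r0 rP]] := nbhs_cabs (proj1 (cvgrPdist_lt _ _) cF _ e0').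
exists r; split=> // z /rP; rewrite -rc_lt rc_cabs distrC; exact.
Qed.

Lemma derive1_of_increment (F : C -> C) (b l : C) (K d : R) : 0 < d ->
  (forall h, cabs h < d -> cabs (F (b + h) - F b - h * l) <= K * cabs h ^+ 2) ->
  derive1 F b = l.
Proof.
move=> d0 FP; rewrite /derive1; apply/cvg_lim; first exact: norm_hausdorff.
apply/cvgrPdist_lt => eps eps0.
have e0 : 0 < cre eps by rewrite -rc_gt0 rc_cre // ltW.
have K0 : 0 < `|K| + 1 by rewrite ltr_wpDl.
(* Within this radius the quadratic error, divided by the modulus of h, is below [eps]. *)
pose q := Num.min d (cre eps / (`|K| + 1)).
have q0 : 0 < rc q by rewrite rc_gt0 lt_min d0 divr_gt0.
near=> h.
have hn0 : h != 0 by near: h; exact: nbhs_dnbhs_neq.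
have : `|h| < rc q by near: h; exact: dnbhs0_lt.
rewrite -rc_cabs rc_lt lt_min => /andP[hd he].
have h0 : 0 < cabs h.
  by rewrite lt_neqAle cabs_ge0 andbT eq_sym; apply: contra hn0 => /eqP/cabs_eq0 ->.
rewrite -rc_cabs -(rc_cre (ltW eps0)) rc_lt.
rewrite -(ltr_pM2r h0) -cabsM -cabsN.
have -> : - ((l - h^-1 *: (F (h + b) - F b)) * h) = F (b + h) - F b - h * l.
  rewrite [h + b]addrC.
  have -> : h^-1 *: (F (b + h) - F b) = h^-1 * (F (b + h) - F b) by [].
  by rewrite mulrBl mulrAC mulVf // mul1r opprB [h * l]mulrC.
apply: le_lt_trans (FP _ hd) _; rewrite expr2 mulrA ltr_pM2r //.
apply: (@le_lt_trans _ _ (`|K| * cabs h)).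
  by rewrite ler_wpM2r ?cabs_ge0 // ler_norm.
apply: (@le_lt_trans _ _ ((`|K| + 1) * cabs h)).
  by rewrite ler_wpM2r ?cabs_ge0 // lerDl.
by rewrite mulrC -ltr_pdivlMr.
Unshelve. all: by end_near.
Qed.
End ComplexTopology.

(** * Derivatives at points of the domain as inner products with kernels *)

Section PointEvaluation.
Variables (R : realType) (X : AHS R).
Local Notation C := (CC R).
Local Notation H := (Hsp X).
Local Notation ip := (@inner _ X).
Implicit Types (b z : C) (p q : {poly C}).

Lemma Om_ball b : Om X b -> exists r : R, 0 < r /\ forall z, cabs (z - b) < r -> Om X z.
Proof. by move=> Omb; apply/nbhs_cabs/open_nbhs_nbhs; split; [exact: Om_open|]. Qed.

(** Each f is bounded near b by continuity, but on a disc depending on f; the eventual form of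
    uniform boundedness over shrinking discs gives one disc for all f. *)
Lemma locally_bounded_eval b : Om X b -> exists r M : R, [/\ 0 < r, 0 <= M &
  forall z, cabs (z - b) <= r -> Om X z /\ forall f : H, cabs (ev f z) <= M * nrm f].
Proof.
move=> Omb; have [r0 [r0_gt0 r0P]] := Om_ball Omb.
pose W (n : nat) z := cabs (z - b) < r0 / n.+1%:R.
have Wdec m n z : (m <= n)%N -> W n z -> W m z.
  move=> mn; rewrite /W => /lt_le_trans; apply.
  by apply: (ler_wpM2l (ltW r0_gt0)); rewrite lef_pV2 ?posrE ?ltr0n // ler_nat.
have WOm n z : W n z -> Om X z.
  by move=> /(Wdec _ _ _ (leq0n n)); rewrite /W divr1; apply: r0P.
have [n [M [M0 MP]]] : exists n (M : R), 0 <= M /\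
    forall z, W n z -> forall f : H, cabs (ev f z) <= M * nrm f.
  apply: (uniform_boundedness (L := fun z f => ev f z)) => //.
    move=> z /WOm Omz; split; last exact: ev_nrm_bound.
    by move=> a f g; apply: ev_lin.
  move=> f; have [r [r_gt0 rP]] := derivable_continuous_cabs (@ev_analytic _ X f _ Omb) ltr01.
  have rr0 : 0 < r / r0 by rewrite divr_gt0.
  have [n nP] := invr_nat_lt rr0.
  exists n, (cabs (ev f b) + 1) => z Wz.
  have zr : cabs (z - b) < r.
    apply: lt_trans Wz _; rewrite mulrC -ltr_pdivlMr //; exact: nP.
  rewrite -[ev f z](subrK (ev f b)) addrC; apply: le_trans (cabsD _ _) _.
  by rewrite lerD2l ltW // rP.
exists (r0 / n.+1%:R / 2), M; split=> //; first by rewrite !divr_gt0 // ltr0n.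
move=> z zb; have Wz : W n z.
  apply: le_lt_trans zb _; have : 0 < r0 / n.+1%:R by rewrite divr_gt0 // ltr0n.
  by rewrite /W; move: (_ / _) => x; lra.
by split; [exact: WOm Wz | exact: MP].
Qed.

Definition poly_el p : H := proj1_sig (cid (poly_in X p)).

Lemma ev_poly_el p z : Om X z -> ev (poly_el p) z = p.[z].
Proof. exact: (proj2_sig (cid (poly_in X p))). Qed.

Lemma poly_el_uniq p h : is_poly_el h p -> h = poly_el p.
Proof. by move=> hp; apply: ev_inj => z Omz; rewrite hp // ev_poly_el. Qed.

Lemma poly_el_lin a p q : poly_el (a *: p + q) = a *: poly_el p + poly_el q.
Proof.
apply: ev_inj => z Omz; rewrite ev_lin // !ev_poly_el //.
by rewrite hornerD hornerZ.
Qed.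

Lemma poly_el_dense (f : H) (e : R) : 0 < e -> exists p, nrm (f - poly_el p) < e.
Proof.
move=> e0; have e20 : 0 < rc (e ^+ 2) by rewrite rc_gt0 exprn_gt0.
have [p [h [hp lt]]] := poly_dense f e20; exists p; rewrite -(poly_el_uniq hp).
by move: lt; rewrite -rc_sqr_nrm rc_lt ltr_pXn2r // nnegrE ?nrm_ge0 // ltW.
Qed.

(** The crude constant m only supplies continuity; the sharper K then passes from polynomials to
    their closure. *)
Lemma dense_bound (L : H -> C) (m K : R) : 0 <= K ->
  (forall f g, L (f + g) = L f + L g) -> (forall f, cabs (L f) <= m * nrm f) ->
  (forall p, cabs (L (poly_el p)) <= K * nrm (poly_el p)) ->
  forall f, cabs (L f) <= K * nrm f.
Proof.
move=> K0 LD Lm LK f; rewrite leNgt; apply/negP => lt.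
pose de := cabs (L f) - K * nrm f.
have c0 : 0 < `|m| + K + 1 by have := normr_ge0 m; lra.
have e0 : 0 < de / (`|m| + K + 1) by rewrite divr_gt0 // /de; lra.
have [p pP] := poly_el_dense f e0; move: pP; rewrite ltr_pdivlMr //.
have := LK p; have := Lm (f - poly_el p); have := LD (f - poly_el p) (poly_el p).
rewrite subrK => Le; have := cabsD (L (f - poly_el p)) (L (poly_el p)).
rewrite -Le; have := nrm_triangle 0 (poly_el p) f.
have := nrmD (poly_el p - f) f; rewrite subrK nrm_distC.
have := nrm_ge0 (f - poly_el p); have := ler_norm m; rewrite /de.
move: (nrm (f - poly_el p)) (nrm (poly_el p)) (nrm f) => x y w.
nra.
Qed.

(** [kern] is an epsilon choice, so a representer must be shown to exist: Cauchy estimates bound the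
    functional on polynomials and Riesz represents it. *)
Lemma Om_is_kernel b l : Om X b -> is_kernel b l (kern X b l).
Proof.
move=> Omb; apply: epsilon_spec.
have [r [M [r0 M0 MP]]] := locally_bounded_eval Omb.
have [|||k kP] := @riesz_representation _ X {poly C} poly_el
  (fun p => (p^`(l)).[b]) (l`!%:R * M / r ^+ l).
- exact: poly_el_lin.
- by move=> a p q; rewrite derivnD derivnZ hornerD hornerZ.
- move=> p; apply: le_trans (derivn_cauchy (B := M * nrm (poly_el p)) l r0 _) _.
    move=> h hr; have [|Oz] := MP (b + h); first by rewrite addrC addKr hr.
    by rewrite -(ev_poly_el p Oz); apply.
  by rewrite mulrA mulrAC.
by exists k => h p /poly_el_uniq ->.
Qed.

Lemma inner_kern_poly b l p : Om X b -> ip (poly_el p) (kern X b l) = (p^`(l)).[b].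
Proof. by move=> Omb; apply: Om_is_kernel => // z; exact: ev_poly_el. Qed.

(** The difference of the two sides is bounded and vanishes on polynomials: [dense_bound] with K =
    0. *)
Lemma ev_kern0 b (f : H) : Om X b -> ev f b = ip f (kern X b 0).
Proof.
move=> Omb; have [m [m0 mP]] := ev_nrm_bound Omb.
have evD (g h : H) : ev (g + h) b = ev g b + ev h b.
  by have := @ev_lin _ X 1 g h _ Omb; rewrite scale1r mul1r.
apply/eqP; rewrite -subr_eq0; apply/eqP/cabs_eq0/le_anti; rewrite cabs_ge0 andbT.
pose L g := ev g b - ip g (kern X b 0).
rewrite -[leRHS](mul0r (nrm f)).
apply: (@dense_bound L (m + nrm (kern X b 0))) => //.
- by move=> g h; rewrite /L evD ipDl; ring.
- move=> g; apply: le_trans (cabsD _ _) _; rewrite cabsN mulrDl lerD //.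
  by rewrite mulrC cauchy_schwarz.
by move=> p; rewrite /L inner_kern_poly // ev_poly_el // subrr cabs0 mul0r.
Qed.

Lemma kern_increment b l : Om X b -> exists d K : R, 0 < d /\
  forall h, cabs h < d -> Om X (b + h) /\ forall f : H,
    cabs (ip f (kern X (b + h) l) - ip f (kern X b l) - h * ip f (kern X b l.+1))
      <= K * nrm f * cabs h ^+ 2.
Proof.
move=> Omb; have [r [M [r0 M0 MP]]] := locally_bounded_eval Omb.
(* [derivn_increment] needs the bound on a disc of twice its radius. *)
pose rho := r / 2; have rho0 : 0 < rho by rewrite divr_gt0.
pose K := 2 * (l`!%:R * M / rho ^+ l) / rho ^+ 2.
have K0 : 0 <= K.
  apply: divr_ge0; last by rewrite exprn_ge0 // ltW.
  rewrite mulr_ge0 // divr_ge0 //; last by rewrite exprn_ge0 // ltW.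
  by rewrite mulr_ge0 ?ler0n.
exists (rho / 2), K; split; first by rewrite divr_gt0.
move=> h hd.
have [|Obh _] := MP (b + h).
  by rewrite addrC addKr; move: hd; rewrite /rho; lra.
split=> // f.
(* The whole increment is pairing with one vector, so Cauchy-Schwarz gives the continuity needed to
   extend the polynomial estimate. *)
pose w := kern X (b + h) l - kern X b l - h^* *: kern X b l.+1.
have wE g : ip g w =
    ip g (kern X (b + h) l) - ip g (kern X b l) - h * ip g (kern X b l.+1).
  by rewrite !ipBr ipZr conjCK.
rewrite -wE mulrAC; apply: (@dense_bound (ip^~ w) (nrm w)).
- by rewrite mulr_ge0 // exprn_ge0 // cabs_ge0.
- by move=> g g'; rewrite ipDl.
- by move=> g; rewrite mulrC cauchy_schwarz.
move=> p; rewrite wE !inner_kern_poly //.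
have pM z : cabs (z - b) <= 2 * rho -> cabs p.[z] <= M * nrm (poly_el p).
  move=> zb; have [|Oz zM] := MP z; first by move: zb; rewrite /rho; lra.
  by rewrite -(ev_poly_el p Oz).
have := @derivn_increment _ p b h rho (M * nrm (poly_el p)) l rho0 _ pM (ltW hd).
rewrite mulr_ge0 ?nrm_ge0 // => /(_ isT) /le_trans; apply.
by rewrite /K le_eqVlt; apply/orP; left; apply/eqP; ring.
Qed.

(** The induction keeps b general, since differentiating at b uses the previous identity at all
    nearby points. *)
Lemma iter_derive1_kern l b (f : H) : Om X b ->
  iter l (fun g => derive1 g) (ev f) b = ip f (kern X b l).
Proof.
elim: l b => [|l IH] b Omb; first exact: ev_kern0.
rewrite iterS; have [d [K [d0 KP]]] := kern_increment l Omb.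
apply: (derive1_of_increment (K := K * nrm f) d0) => h /KP[Obh hP].
by rewrite !IH.
Qed.
End PointEvaluation.

(** * Multisets as duplicate-free lists of pairs (point, order) *)

Section KernelIndices.
Variable R : realType.
Local Notation C := (CC R).

(** The orders decrease as in [kblock], so that [SS] becomes a [Dform] over indices with no
    reordering. *)
Definition block_idx (b : C) (m : nat) : seq (C * nat) :=
  [seq (b, m - 1 - i)%N | i <- iota 0 m].

Definition pts_idx (s : seq (C * nat)) : seq (C * nat) :=
  flatten [seq block_idx x.1 x.2 | x <- s].

Definition kernel_idx (Z : fmset R) : seq (C * nat) :=
  block_idx 0 (rm0 Z) ++ pts_idx (rpts Z).

Lemma mem_block_idx b m x : (x \in block_idx b m) = (x.1 == b) && (x.2 < m)%N.
Proof.
apply/mapP/andP => [[k]|[/eqP e lt]].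
  by rewrite mem_iota add0n => km -> /=; rewrite eqxx; lia.
exists (m - 1 - x.2)%N; first by rewrite mem_iota; lia.
by rewrite -e [LHS]surjective_pairing; congr (_, _); lia.
Qed.

Lemma uniq_block_idx b m : uniq (block_idx b m).
Proof.
rewrite map_inj_in_uniq ?iota_uniq // => i j.
by rewrite !mem_iota => hi hj []; lia.
Qed.

Lemma mult_notin (s : seq (C * nat)) b : b \notin map fst s ->
  (\sum_(x <- s | x.1 == b) x.2 = 0)%N.
Proof.
move=> bs; rewrite big_seq_cond big1 // => x /andP[xs /eqP e].
by rewrite -e map_f in bs.
Qed.

Lemma mem_pts_idx (s : seq (C * nat)) b l : uniq (map fst s) ->
  ((b, l) \in pts_idx s) = (l < \sum_(x <- s | x.1 == b) x.2)%N.
Proof.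
elim: s => [|[b' m] s IH] /=; first by rewrite big_nil.
move=> /andP[b's us]; rewrite mem_cat mem_block_idx IH //= big_cons /=.
rewrite eq_sym; case: eqP => [<-|//].
by rewrite mult_notin // addn0 orbF.
Qed.

Lemma uniq_pts_idx (s : seq (C * nat)) : uniq (map fst s) -> uniq (pts_idx s).
Proof.
elim: s => [|[b m] s IH] //= /andP[bs us].
rewrite /pts_idx /= cat_uniq uniq_block_idx IH // andbT /=.
apply/hasPn => -[b' l]; rewrite mem_pts_idx // => hl.
apply/negP; rewrite mem_block_idx => /andP[/= /eqP e _].
by rewrite e mult_notin in hl.
Qed.

Variable X : AHS R.

Section Multiset.
Variables (Z : fmset R) (ZP : reproducible_multiset X Z).

Let zero_notin : 0 \notin map fst (rpts Z).
Proof. by apply/mapP => -[x /(proj2 ZP)[x0 _ _] e]; rewrite -e eqxx in x0. Qed.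

(** Turns inclusion of multisets into inclusion of lists; it holds at the origin because 0 is not
    among the listed points. *)
Lemma mem_kernel_idx b l : ((b, l) \in kernel_idx Z) = (l < mult Z b)%N.
Proof.
rewrite mem_cat mem_block_idx mem_pts_idx ?(proj1 ZP) //= /mult.
by case: eqP => [->|//]; rewrite mult_notin ?orbF.
Qed.

Lemma uniq_kernel_idx : uniq (kernel_idx Z).
Proof.
rewrite cat_uniq uniq_block_idx uniq_pts_idx ?(proj1 ZP) // andbT /=.
apply/hasPn => -[b l]; rewrite mem_pts_idx ?(proj1 ZP) // => hl.
apply/negP; rewrite mem_block_idx => /andP[/= /eqP e _].
by rewrite e mult_notin in hl.
Qed.

Lemma SS_kernel_idx : SS X Z =
  Dform (kern X 0 (rm0 Z)) [seq kern X x.1 x.2 | x <- kernel_idx Z].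
Proof.
rewrite /SS /kernel_idx map_cat /pts_idx map_flatten -!map_comp.
congr (Dform _ (_ ++ flatten _)); apply: eq_map => x /=.
by rewrite /kblock /block_idx -map_comp.
Qed.
End Multiset.

(** Inside the domain this is [iter_derive1_kern]; outside, [ext_deriv] is by definition the inner
    product. *)
Lemma zero_mult_ge_orth (f : Hsp X) b m l : zero_mult_ge f b m -> (l < m)%N ->
  inner f (kern X b l) = 0.
Proof.
move=> [zin zout] lm; have [Omb|nOmb] := pselect (Om X b).
  by rewrite -iter_derive1_kern // zin.
by case: (zout nOmb) => [m0|[_]]; [rewrite m0 in lm | apply].
Qed.
End KernelIndices.

(** * Reduction of the theorem to enlarging a family of kernels *)

Theorem mainTheorem15 (R : realType) (X : AHS R) (A B : fmset R) :
  reproducible_multiset X A ->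
  reproducible_multiset X B ->
  (forall beta : CC R, (mult A beta <= mult B beta)%N) ->
  (forall beta : CC R, zero_mult_ge (SS X A) beta (mult B beta)) ->
  exists c : CC R, SS X B = c *: SS X A.
Proof.
move=> AP BP AB zeros.
have m0 Z : mult Z (0 : CC R) = rm0 Z by rewrite /mult eqxx.
rewrite !SS_kernel_idx in zeros *.
apply: (@Dform_enlarge _ _ _ (fun x => kern X x.1 x.2) _ _ (0, rm0 A) (0, rm0 B)).
- exact: uniq_kernel_idx AP.
- exact: uniq_kernel_idx BP.
- move=> [b l]; rewrite (mem_kernel_idx AP) (mem_kernel_idx BP) => /leq_trans; exact.
- by rewrite (mem_kernel_idx AP) m0 ltnn.
(* Either the multiplicities at 0 agree, or that of B is larger and [(0, rm0 A)] is an index of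
   B. *)
- have := AB 0; rewrite (mem_kernel_idx BP) !m0 leq_eqVlt.
  by case/predU1P => [->|]; [left | right].
- move=> [b l]; rewrite (mem_kernel_idx BP) => lB.
  exact: zero_mult_ge_orth (zeros b) lB.
Qed.
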